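(* Let $V$ be a finite set of boxes and let $w,w':V\to[0,1]^d$ be size functions. Let $\mathcal E_{+}=(\mathcal E_{+,1},\dots,\mathcal E_{+,d})$ be a $d$-tuple of edge sets on $V$, and let $(G_1,\dots,G_d)$, $G_i=(V,E_i)$, be a packing class for $(V,w)$ with $\mathcal E_{+,i}\subseteq E_i$ for $i=1,\dots,d$. Suppose that for all $i\in\{1,\dots,d\}$, $$\mathcal F(V,w_i,\mathcal E_{+,i})\subseteq\mathcal F(V,w'_i).$$ Then $(G_1,\dots,G_d)$ is a packing class for $(V,w')$.
   Context: For a size function $w$ and coordinate $i$, $\mathcal F(V,w_i)=\{S\subseteq V:\sum_{b\in S}w_i(b)\le1\}$. For $S\subseteq V$, $K(S)$ denotes the edge set of the complete graph on $S$, and for an edge set $\mathcal E$ on $V$, $\mathcal F(V,w_i,\mathcal E)=\{S\in\mathcal F(V,w_i): K(S)\cap\mathcal E=\emptyset\}$. A packing class for $(V,w)$ is a $d$-tuple of graphs $G_i=(V,E_i)$ such that each $G_i$ is an interval graph, every stable set of $G_i$ lies in $\mathcal F(V,w_i)$, and $\bigcap_{i=1}^dE_i=\emptyset$. *)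

(* Defs.v *)
(* MathComp, with the real numbers as a [realType]. *)
From HB Require Import structures.
From mathcomp Require Import all_boot all_order all_algebra.
From mathcomp Require Import reals.

Set Implicit Arguments.
Unset Strict Implicit.
Unset Printing Implicit Defensive.

Import Order.TTheory GRing.Theory Num.Theory.
Local Open Scope ring_scope.

(* The edges of the complete graph on V: loops are excluded by the type, so
   every [{set edge V}] is the edge set of a simple graph with vertex set V. *)
Definition edge (V : finType) : finType := {e : {set V} | #|e| == 2%N}.

Definition adjacent (V : finType) (E : {set edge V}) (u v : V) : bool :=
  [set u; v] \in [set val e | e in E].

Definition complete_edges (V : finType) (S : {set V}) : {set edge V} :=
  [set e : edge V | val e \subset S].

Definition stable (V : finType) (E : {set edge V}) (S : {set V}) : bool :=
  [forall u in S, forall v in S, ~~ adjacent E u v].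

Definition interval_graph (R : realType) (V : finType) (E : {set edge V}) :
    Prop :=
  exists I : V -> interval R,
    (forall v, exists x, x \in I v) /\
    (forall u v, u != v ->
       adjacent E u v <-> exists x, x \in I u /\ x \in I v).

Definition size_function (R : realType) (V : finType) (d : nat)
    (w : V -> 'rV[R]_d) : Prop :=
  forall b i, 0 <= w b 0 i <= 1.

Definition size_coord (R : realType) (V : finType) (d : nat)
    (w : V -> 'rV[R]_d) (i : 'I_d) : V -> R := fun b => w b 0 i.

Definition feasible (R : realType) (V : finType) (f : V -> R) :
    {set {set V}} :=
  [set S : {set V} | \sum_(b in S) f b <= 1].

Definition feasible_wrt (R : realType) (V : finType) (f : V -> R)
    (E : {set edge V}) : {set {set V}} :=
  [set S in feasible f | complete_edges S :&: E == set0].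

Definition packing_class (R : realType) (V : finType) (d : nat)
    (w : V -> 'rV[R]_d) (E : 'I_d -> {set edge V}) : Prop :=
  [/\ forall i, interval_graph R (E i),
      forall i (S : {set V}), stable (E i) S -> S \in feasible (size_coord w i)
    & \bigcap_(i < d) E i = set0].

(* Main.v *)
Require Import Defs.
From mathcomp Require Import all_boot all_order all_algebra.
From mathcomp Require Import reals.

(** Only the stable-set condition of a packing class involves the sizes. If $S$ is stable in $G_i$,
    then it is feasible for $w_i$, and $K(S)$ misses $E_i$ ([stable_complete_edges]), hence also the
    smaller set $\mathcal E_{+,i}$. So $S\in\mathcal F(V,w_i,\mathcal E_{+,i})$, and [hF] makes it
    feasible for $w'_i$. *)

Lemma stable_complete_edges (V : finType) (E : {set edge V}) (S : {set V}) :
  stable E S -> complete_edges S :&: E = set0.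
Proof.
move=> /forall_inP stS; apply/setP => e; rewrite !inE.
apply/negP => /andP[eS eE].
have /cards2P[u [v [_ euv]]] := valP e.
move: eS; rewrite euv subUset !sub1set => /andP[uS vS].
have /forall_inP/(_ v vS)/negP := stS u uS; apply.
by apply/imsetP; exists e.
Qed.

Theorem theorem17 (R : realType) (V : finType) (d : nat)
  (w w' : V -> 'rV[R]_d)
  (hw : size_function w) (hw' : size_function w')
  (Eplus E : 'I_d -> {set edge V})
  (hE : packing_class w E)
  (hsub : forall i : 'I_d, Eplus i \subset E i)
  (hF : forall i : 'I_d,
     feasible_wrt (size_coord w i) (Eplus i) \subset feasible (size_coord w' i)) :
  packing_class w' E.
Proof.
case: hE => interval_E stable_w cap_E; split=> // i S stS.
apply: (subsetP (hF i)); rewrite inE stable_w //=.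
(* The bound [set0] is written back as $K(S)\cap E_i$, which leaves monotonicity of intersection,
   applied to [hsub]. *)
by rewrite -subset0 -(stable_complete_edges _ _ _ stS) setIS.
Qed.
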